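(* Consider the system $$x(k+1)=A_0x(k)+A_1x(k-h_1(k))+Bu(k-h_2(k)),\qquad k\in\mathbb{Z}_{\ge0},\qquad(\ast)$$ with $x(k)\in\mathbb{R}^n$, $u(k)\in\mathbb{R}^m$, and unknown constant real matrices $A_0,A_1,B$. Let the recorded data be corrupted by noise, $x=x^{\mathrm{nom}}+x^\delta$, $u=u^{\mathrm{nom}}+u^\delta$, as described in the context, let $U_{h_2,\{0\}},X_{h_1,\{0\}},X_{\{0\}},X_{\{1\}},W_0$ be the matrices built from the recorded (noisy) data as in the context, and suppose that $\mathrm{rank}(W_0)=m+2n$. Suppose that $$\Delta_{[\cdot]}:=\begin{bmatrix}B & A_1 & A_0\end{bmatrix}W_0^\delta-X_{\{1\}}^\delta$$ is bounded as $\|\Delta_{[\cdot]}\|_2\le\alpha$, with $\alpha>0$ known. Given a positive (integer) delay bound $\bar h$ and a tuning parameter $\varepsilon>0$, let there exist $n\times n$ matrices $\bar P>0$, $\bar S>0$, $\bar R_i>0$, $\bar S_{12,i}$, $i\in\{1,2\}$, $T\times n$ matrices $Q_1,Q_2,Q_3$, and $\lambda>0$ such that $$\begin{bmatrix}\bar{\mathbf{\Phi}}-\alpha^2\lambda I_{5n} & \mathbf{Q}^\top\\ \mathbf{Q} & \lambda I_{5T}\end{bmatrix}>0,\qquad \begin{bmatrix}\bar R_i & \bar S_{12,i}\\ \star & \bar R_i\end{bmatrix}\ge0,\quad i\in\{1,2\},$$ together with $$\begin{aligned}U_{h_2,\{0\}}Q_2&=U_{h_2,\{0\}}Q_3=0,\\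 X_{h_1,\{0\}}Q_1&=X_{h_1,\{0\}}Q_3=0,\\ X_{\{0\}}Q_1&=X_{\{0\}}Q_2=0,\\ X_{h_1,\{0\}}Q_2&=X_{\{0\}}Q_3\end{aligned}$$ hold, where $\bar{\mathbf{\Phi}}$ is given in the context and $$\mathbf{Q}=\begin{bmatrix}Q_3 & Q_2 & Q_1 & 0 & 0\\ 0&0&0&0&0\\ 0&0&0&0&0\\ 0&0&0&0&0\\ \varepsilon Q_3 & \varepsilon Q_2 & \varepsilon Q_1 & 0 & 0\end{bmatrix}\in\mathbb{R}^{5T\times5n}.$$ Choose the feedback gain $$K=U_{h_2,\{0\}}Q_1\big(X_{\{0\}}Q_3\big)^{-1}.$$ Then for all delays $h_1(k)\in[0,\bar h]$ and $h_2(k)\in[0,\bar h]$ for all $k\in\mathbb{Z}_{\ge0}$, the origin of $(\ast)$ in closed loop (with $u(k)=Kx(k)$) is asymptotically stable.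
   Context: Closed loop: $x(k+1)=A_0x(k)+A_1x(k-h_1(k))+BKx(k-h_2(k))$, where $h_1(k),h_2(k)$ are integer-valued, possibly time-varying, uncertain delays; initial conditions are histories $x(j)$, $j\in\mathbb{Z}\cap[-\bar h,0]$. Recorded data: for $k=-\bar h,\dots,T$, with $T>\bar h$, the available sequences are $x(k)=x^{\mathrm{nom}}(k)+x^\delta(k)\in\mathbb{R}^n$ and $u(k)=u^{\mathrm{nom}}(k)+u^\delta(k)\in\mathbb{R}^m$, where the nominal part satisfies $x^{\mathrm{nom}}(k+1)=A_0x^{\mathrm{nom}}(k)+A_1x^{\mathrm{nom}}(k-h_1)+Bu^{\mathrm{nom}}(k-h_2)$ for $k=0,\dots,T-1$ with constant delays $h_1,h_2\in\{0,\dots,\bar h\}$ (constant while the data are recorded, though they may vary in closed-loop operation), and the superscript $\delta$ denotes measurement noise. Set $U_{h_2,\{0\}}=[u(-h_2)\ \cdots\ u(T-1-h_2)]$, $X_{h_1,\{0\}}=[x(-h_1)\ \cdots\ x(T-1-h_1)]$, $X_{\{0\}}=[x(0)\ \cdots\ x(T-1)]$, $X_{\{1\}}=[x(1)\ \cdots\ x(T)]$, and $W_0=\begin{bmatrix}U_{h_2,\{0\}}\\ X_{h_1,\{0\}}\\ X_{\{0\}}\end{bmatrix}\in\mathbb{R}^{(m+2n)\times T}$. $W_0^\delta$ and $X_{\{1\}}^\delta$ are the same matrices built from the noise sequences $u^\delta,x^\delta$, so $W_0=W_0^{\mathrm{nom}}+W_0^\delta$ and $X_{\{1\}}=X_{\{1\}}^{\mathrm{nom}}+X_{\{1\}}^\delta$.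 $\|\cdot\|_2$ is the induced Euclidean (spectral) norm. $M>0$ means $M$ is symmetric positive definite; $\star$ denotes entries below the diagonal determined by symmetry. The symmetric $5n\times5n$ matrix $\bar{\mathbf{\Phi}}$ is $$\bar{\mathbf{\Phi}}=\begin{bmatrix} \bar{\mathbf{\Phi}}_{11} & \bar{\mathbf{\Phi}}_{12} & \bar{\mathbf{\Phi}}_{13} & -\bar S_{12,1}-\bar S_{12,2} & \bar{\mathbf{\Phi}}_{15}\\ \star & 2\bar R_1-\bar S_{12,1}-\bar S_{12,1}^\top & 0 & -\bar R_1+\bar S_{12,1} & -\varepsilon(X_{\{1\}}Q_2)^\top\\ \star & \star & 2\bar R_2-\bar S_{12,2}-\bar S_{12,2}^\top & -\bar R_2+\bar S_{12,2} & -\varepsilon(X_{\{1\}}Q_1)^\top\\ \star & \star & \star & \bar R_1+\bar R_2+\bar S & 0\\ \star & \star & \star & \star & \bar{\mathbf{\Phi}}_{55}\end{bmatrix},$$ with $\bar{\mathbf{\Phi}}_{11}=\bar P-\bar S+(1-\bar h^2)(\bar R_1+\bar R_2)-X_{\{1\}}Q_3-(X_{\{1\}}Q_3)^\top$, $\bar{\mathbf{\Phi}}_{12}=-\bar R_1+\bar S_{12,1}-X_{\{1\}}Q_2$, $\bar{\mathbf{\Phi}}_{13}=-\bar R_2+\bar S_{12,2}-X_{\{1\}}Q_1$, $\bar{\mathbf{\Phi}}_{15}=\bar h^2(\bar R_1+\bar R_2)+X_{\{0\}}Q_3-\varepsilon(X_{\{1\}}Q_3)^\top$, $\bar{\mathbf{\Phi}}_{55}=-\bar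 P-\bar h^2(\bar R_1+\bar R_2)+\varepsilon(X_{\{0\}}Q_3+Q_3^\top X_{\{0\}}^\top)$. (The first matrix inequality implies $\bar{\mathbf{\Phi}}>0$, hence $X_{\{0\}}Q_3$ is nonsingular and $K$ is well defined.) *)

(* Defs.v *)
From HB Require Import structures.
From mathcomp Require Import all_boot all_order all_algebra.
From mathcomp Require Import all_classical all_reals all_analysis.

Set Implicit Arguments.
Unset Strict Implicit.
Unset Printing Implicit Defensive.

Import Order.TTheory GRing.Theory Num.Theory.
Import numFieldNormedType.Exports.

Local Open Scope classical_set_scope.
Local Open Scope ring_scope.

(* The library norm `|v| on matrices is the max norm, hence this one. *)
Definition enorm (R : realType) (p : nat) (v : 'cV[R]_p) : R :=
  Num.sqrt (\sum_(i < p) v i 0 ^+ 2).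

Definition spectral_norm (R : realType) (p q : nat) (A : 'M[R]_(p, q)) : R :=
  sup [set enorm (A *m v) | v in [set v : 'cV[R]_q | enorm v <= 1]].

Definition posdef (R : realType) (p : nat) (M : 'M[R]_p) : Prop :=
  M^T = M /\ forall v : 'cV[R]_p, v != 0 -> 0 < (v^T *m M *m v) 0 0.

Definition possemidef (R : realType) (p : nat) (M : 'M[R]_p) : Prop :=
  M^T = M /\ forall v : 'cV[R]_p, 0 <= (v^T *m M *m v) 0 0.

Definition row5 (R : realType) (p q : nat) (a b c d e : 'M[R]_(p, q)) :
    'M[R]_(p, q + (q + (q + (q + q)))) :=
  row_mx a (row_mx b (row_mx c (row_mx d e))).

Definition col5 (R : realType) (p q : nat) (a b c d e : 'M[R]_(p, q)) :
    'M[R]_(p + (p + (p + (p + p))), q) :=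
  col_mx a (col_mx b (col_mx c (col_mx d e))).

Definition symblock5 (R : realType) (n : nat)
    (a11 a12 a13 a14 a15 a22 a23 a24 a25 a33 a34 a35 a44 a45 a55 : 'M[R]_n) :
    'M[R]_(n + (n + (n + (n + n)))) :=
  col5 (row5 a11   a12   a13   a14   a15)
       (row5 a12^T a22   a23   a24   a25)
       (row5 a13^T a23^T a33   a34   a35)
       (row5 a14^T a24^T a34^T a44   a45)
       (row5 a15^T a25^T a35^T a45^T a55).

(* Signals are functions on all of int, of which only the values at times
   at least - hbar are ever used. *)

(* [ z(s)  z(s + 1)  ...  z(s + T - 1) ] *)
Definition data_mx (R : realType) (p T : nat) (z : int -> 'cV[R]_p) (s : int) :
    'M[R]_(p, T) :=
  \matrix_(i < p, j < T) z (s + j%:Z) i 0.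

Definition W_mx (R : realType) (m n T : nat) (h1 h2 : nat)
    (u : int -> 'cV[R]_m) (x : int -> 'cV[R]_n) : 'M[R]_(m + (n + n), T) :=
  col_mx (data_mx T u (- h2%:Z))
         (col_mx (data_mx T x (- h1%:Z)) (data_mx T x 0)).

Definition delay_step (R : realType) (m n : nat)
    (A0 A1 : 'M[R]_n) (B : 'M[R]_(n, m)) (h1 h2 : nat)
    (x : int -> 'cV[R]_n) (u : int -> 'cV[R]_m) (k : nat) : Prop :=
  x (k%:Z + 1) = A0 *m x k%:Z + A1 *m x (k%:Z - h1%:Z) + B *m u (k%:Z - h2%:Z).

Definition closed_loop (R : realType) (m n : nat)
    (A0 A1 : 'M[R]_n) (B : 'M[R]_(n, m)) (K : 'M[R]_(m, n))
    (h1 h2 : nat -> nat) (x : int -> 'cV[R]_n) : Prop :=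
  forall k : nat,
    delay_step A0 A1 B (h1 k) (h2 k) x (fun j => K *m x j) k.

Definition history_lt (R : realType) (n hbar : nat) (d : R)
    (x : int -> 'cV[R]_n) : Prop :=
  forall j : int, - hbar%:Z <= j -> j <= 0 -> enorm (x j) < d.

(* Lyapunov stability and attractivity of the origin, for the system whose
   solutions are the x with [sol x]; the initial condition of a solution is its
   history on [- hbar, 0]. *)
Definition asymptotically_stable (R : realType) (n hbar : nat)
    (sol : (int -> 'cV[R]_n) -> Prop) : Prop :=
  (forall e : R, 0 < e -> exists2 d : R, 0 < d &
     forall x : int -> 'cV[R]_n, sol x -> history_lt hbar d x ->
     forall k : nat, enorm (x k%:Z) < e)
  /\
  (exists2 d : R, 0 < d &
     forall x : int -> 'cV[R]_n, sol x -> history_lt hbar d x ->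
     x k%:Z @[k --> \oo] --> (0 : 'cV[R]_n)).

Definition Phi_mx (R : realType) (n T hbar : nat) (eps : R)
    (X0 X1 : 'M[R]_(n, T)) (P S R1 R2 S12_1 S12_2 : 'M[R]_n)
    (Q1 Q2 Q3 : 'M[R]_(T, n)) : 'M[R]_(n + (n + (n + (n + n)))) :=
  let h : R := hbar%:R in
  symblock5
    (P - S + (1 - h ^+ 2) *: (R1 + R2) - X1 *m Q3 - (X1 *m Q3)^T)
    (- R1 + S12_1 - X1 *m Q2)
    (- R2 + S12_2 - X1 *m Q1)
    (- S12_1 - S12_2)
    (h ^+ 2 *: (R1 + R2) + X0 *m Q3 - eps *: (X1 *m Q3)^T)
    (2 *: R1 - S12_1 - S12_1^T)
    0
    (- R1 + S12_1)
    (- (eps *: (X1 *m Q2)^T))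
    (2 *: R2 - S12_2 - S12_2^T)
    (- R2 + S12_2)
    (- (eps *: (X1 *m Q1)^T))
    (R1 + R2 + S)
    0
    (- P - h ^+ 2 *: (R1 + R2) + eps *: (X0 *m Q3 + Q3^T *m X0^T)).

Definition Q_mx (R : realType) (n T : nat) (eps : R) (Q1 Q2 Q3 : 'M[R]_(T, n)) :
    'M[R]_(T + (T + (T + (T + T))), n + (n + (n + (n + n)))) :=
  col5 (row5 Q3 Q2 Q1 0 0)
       (row5 0 0 0 0 0)
       (row5 0 0 0 0 0)
       (row5 0 0 0 0 0)
       (row5 (eps *: Q3) (eps *: Q2) (eps *: Q1) 0 0).

(* Main.v *)
Require Import Defs.
From HB Require Import structures.
From mathcomp Require Import all_boot all_order all_algebra ring lra zify.
From mathcomp Require Import all_classical all_reals all_analysis.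

Set Implicit Arguments.
Unset Strict Implicit.
Unset Printing Implicit Defensive.

Import Order.TTheory GRing.Theory Num.Theory.
Import numFieldNormedType.Exports.

Local Open Scope classical_set_scope.
Local Open Scope ring_scope.

(* By the data equation, X1 + Delta = B U + A1 Xh + A0 X0, so the constraints
   on the Q_i give (X1 + Delta) Q3 = A0 Y, (X1 + Delta) Q2 = A1 Y and
   (X1 + Delta) Q1 = B K Y with Y = X0 Q3. In the coordinates w = Y^-1 x, the
   quadratic form of Phi with X1 + Delta in place of X1, evaluated at
   (w(k), w(k - h1), w(k - h2), w(k - hbar), w(k + 1)), bounds from below the
   decrease of a Lyapunov-Krasovskii functional, by Jensen's inequality and the
   reciprocally convex combination; the terms with X0 and X1 + Delta form the
   vanishing product 2 (w(k) + eps w(k + 1))^T (Y w(k + 1) - (X1 + Delta) q),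
   where q = Q3 w(k) + Q2 w(k - h1) + Q1 w(k - h2).
   The matrix inequality makes this form positive definite for every admissible
   Delta. *)

(** * Bilinear forms and the Euclidean inner product *)

Definition bform (R : realType) (p q : nat) (M : 'M[R]_(p, q)) (u : 'cV[R]_p)
    (v : 'cV[R]_q) : R := (u^T *m M *m v) 0 0.

Definition dot (R : realType) (p : nat) (u v : 'cV[R]_p) : R := (u^T *m v) 0 0.

Lemma bformDl (R : realType) p q (M : 'M[R]_(p, q)) u1 u2 v :
  bform M (u1 + u2) v = bform M u1 v + bform M u2 v.
Proof. by rewrite /bform linearD /= !mulmxDl mxE. Qed.

Lemma bformDr (R : realType) p q (M : 'M[R]_(p, q)) u v1 v2 :
  bform M u (v1 + v2) = bform M u v1 + bform M u v2.
Proof. by rewrite /bform mulmxDr mxE. Qed.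

Lemma bformNl (R : realType) p q (M : 'M[R]_(p, q)) u v :
  bform M (- u) v = - bform M u v.
Proof. by rewrite /bform linearN /= !mulNmx mxE. Qed.

Lemma bformNr (R : realType) p q (M : 'M[R]_(p, q)) u v :
  bform M u (- v) = - bform M u v.
Proof. by rewrite /bform mulmxN mxE. Qed.

Lemma bformZl (R : realType) p q (M : 'M[R]_(p, q)) c u v :
  bform M (c *: u) v = c * bform M u v.
Proof. by rewrite /bform linearZ /= -!scalemxAl mxE. Qed.

Lemma bformZr (R : realType) p q (M : 'M[R]_(p, q)) c u v :
  bform M u (c *: v) = c * bform M u v.
Proof. by rewrite /bform -scalemxAr mxE. Qed.

Lemma bform0l (R : realType) p q (M : 'M[R]_(p, q)) v : bform M 0 v = 0.
Proof. by rewrite /bform trmx0 !mul0mx mxE. Qed.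

Lemma bform0r (R : realType) p q (M : 'M[R]_(p, q)) u : bform M u 0 = 0.
Proof. by rewrite /bform mulmx0 mxE. Qed.

Lemma bformD (R : realType) p q (M N : 'M[R]_(p, q)) u v :
  bform (M + N) u v = bform M u v + bform N u v.
Proof. by rewrite /bform mulmxDr mulmxDl mxE. Qed.

Lemma bformN (R : realType) p q (M : 'M[R]_(p, q)) u v :
  bform (- M) u v = - bform M u v.
Proof. by rewrite /bform mulmxN mulNmx mxE. Qed.

Lemma bformZ (R : realType) p q (M : 'M[R]_(p, q)) c u v :
  bform (c *: M) u v = c * bform M u v.
Proof. by rewrite /bform -scalemxAr -scalemxAl mxE. Qed.

Lemma bform0 (R : realType) p q u v : bform (0 : 'M[R]_(p, q)) u v = 0.
Proof. by rewrite /bform mulmx0 mul0mx mxE. Qed.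

Lemma bformT (R : realType) p q (M : 'M[R]_(p, q)) u v :
  bform M^T u v = bform M v u.
Proof.
rewrite /bform; transitivity ((v^T *m M *m u)^T 0 0); last by rewrite mxE.
by rewrite !trmx_mul trmxK mulmxA.
Qed.

Lemma bformC (R : realType) p (M : 'M[R]_p) u v :
  M^T = M -> bform M u v = bform M v u.
Proof. by move=> Msym; rewrite -bformT Msym. Qed.

Lemma bform_scalar (R : realType) p (c : R) (u v : 'cV[R]_p) :
  bform c%:M u v = c * dot u v.
Proof. by rewrite /bform mul_mx_scalar -scalemxAl mxE. Qed.

Lemma bform1 (R : realType) p (u v : 'cV[R]_p) : bform 1%:M u v = dot u v.
Proof. by rewrite bform_scalar mul1r. Qed.

Lemma bform_dot (R : realType) p q (M : 'M[R]_(p, q)) u v :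
  bform M u v = dot u (M *m v).
Proof. by rewrite /bform /dot mulmxA. Qed.

Lemma bform_col (R : realType) p1 p2 q (M : 'M[R]_(p1, q)) (N : 'M[R]_(p2, q))
    u1 u2 v :
  bform (col_mx M N) (col_mx u1 u2) v = bform M u1 v + bform N u2 v.
Proof. by rewrite /bform tr_col_mx mul_row_col mulmxDl mxE. Qed.

Lemma bform_row (R : realType) p q1 q2 (M : 'M[R]_(p, q1)) (N : 'M[R]_(p, q2))
    u v1 v2 :
  bform (row_mx M N) u (col_mx v1 v2) = bform M u v1 + bform N u v2.
Proof. by rewrite /bform mul_mx_row mul_row_col mxE. Qed.

Lemma dotC (R : realType) p (u v : 'cV[R]_p) : dot u v = dot v u.
Proof. by rewrite -!bform1 -[in LHS]tr_scalar_mx bformT. Qed.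

Lemma dotE (R : realType) p (u v : 'cV[R]_p) :
  dot u v = \sum_(i < p) u i 0 * v i 0.
Proof. by rewrite /dot mxE; apply: eq_bigr => i _; rewrite mxE. Qed.

Lemma dot_ge0 (R : realType) p (v : 'cV[R]_p) : 0 <= dot v v.
Proof. by rewrite dotE sumr_ge0 // => i _; rewrite -expr2 sqr_ge0. Qed.

Lemma sqr_coord_le_dot (R : realType) p (v : 'cV[R]_p) i :
  v i 0 ^+ 2 <= dot v v.
Proof.
rewrite dotE (bigD1 i) //= expr2 lerDl sumr_ge0 // => j _.
by rewrite -expr2 sqr_ge0.
Qed.

Lemma dot_eq0 (R : realType) p (v : 'cV[R]_p) : dot v v = 0 -> v = 0.
Proof.
move=> v0; apply/matrixP => i j; rewrite ord1 mxE.
have := sqr_coord_le_dot v i; rewrite v0 => le0.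
by apply/eqP; rewrite -sqrf_eq0 eq_le le0 sqr_ge0.
Qed.

Lemma dot_col (R : realType) p q (u1 v1 : 'cV[R]_p) (u2 v2 : 'cV[R]_q) :
  dot (col_mx u1 u2) (col_mx v1 v2) = dot u1 v1 + dot u2 v2.
Proof. by rewrite /dot tr_col_mx mul_row_col mxE. Qed.

Lemma dotDr (R : realType) p (u v1 v2 : 'cV[R]_p) :
  dot u (v1 + v2) = dot u v1 + dot u v2.
Proof. by rewrite -!bform1 bformDr. Qed.

Lemma dotZl (R : realType) p c (u v : 'cV[R]_p) : dot (c *: u) v = c * dot u v.
Proof. by rewrite -!bform1 bformZl. Qed.

Lemma dotZr (R : realType) p c (u v : 'cV[R]_p) : dot u (c *: v) = c * dot u v.
Proof. by rewrite -!bform1 bformZr. Qed.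

Lemma dot0l (R : realType) p (v : 'cV[R]_p) : dot 0 v = 0.
Proof. by rewrite -bform1 bform0l. Qed.

Lemma dot0r (R : realType) p (v : 'cV[R]_p) : dot v 0 = 0.
Proof. by rewrite -bform1 bform0r. Qed.

Lemma dot_sub_le (R : realType) p (u v : 'cV[R]_p) :
  dot (u - v) (u - v) <= 2 * dot u u + 2 * dot v v.
Proof.
have := dot_ge0 (u + v).
rewrite -!bform1 !(bformDl, bformDr, bformNl, bformNr) !bform1 (dotC v u).
by lra.
Qed.

Lemma sqr_enorm (R : realType) p (v : 'cV[R]_p) : enorm v ^+ 2 = dot v v.
Proof.
have -> : enorm v = Num.sqrt (dot v v).
  by rewrite dotE; congr Num.sqrt; apply: eq_bigr => i _; rewrite expr2.
by rewrite sqr_sqrtr ?dot_ge0.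
Qed.

Lemma enorm_ltP (R : realType) p (v : 'cV[R]_p) (e : R) : 0 < e ->
  (enorm v < e) = (dot v v < e ^+ 2).
Proof.
by move=> e0; rewrite -sqr_enorm ltr_pXn2r // nnegrE ?sqrtr_ge0 // ltW.
Qed.

(** * Bounds on quadratic forms, coercivity and the spectral norm *)

Lemma bform_le_dot (R : realType) p (M : 'M[R]_p) :
  exists2 C : R, 0 < C & forall v, bform M v v <= C * dot v v.
Proof.
(* Each product [v i 0 * v j 0] is at most [dot v v] in absolute value; the summand 1 keeps the
   constant positive even for [M = 0]. *)
exists (1 + \sum_i \sum_j `|M i j|).
  by rewrite ltr_pwDl // sumr_ge0 // => i _; rewrite sumr_ge0.
move=> v; rewrite mulrDl mul1r -[leLHS]add0r lerD ?dot_ge0 //.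
rewrite bform_dot dotE mulr_suml ler_sum // => i _.
rewrite mxE mulr_sumr mulr_suml ler_sum // => j _.
rewrite mulrCA; apply: le_trans (ler_norm _) _; rewrite normrM.
rewrite ler_wpM2l // ler_norml.
have := sqr_coord_le_dot v i; have := sqr_coord_le_dot v j.
have := sqr_ge0 (v i 0 + v j 0); have := sqr_ge0 (v i 0 - v j 0).
by nra.
Qed.

Lemma unitmx_ker0 (R : realType) p (M : 'M[R]_p) :
  (forall v : 'cV[R]_p, M *m v = 0 -> v = 0) -> M \in unitmx.
Proof.
move=> ker0; rewrite -unitmx_tr -row_free_unit -kermx_eq0; apply/eqP.
apply/eqP/rowV0P => v /sub_kermxP vM; apply: trmx_inj; rewrite trmx0.
by apply: ker0; rewrite -[M]trmxK -trmx_mul vM trmx0.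
Qed.

Lemma posdef_ge0 (R : realType) p (M : 'M[R]_p) v :
  posdef M -> 0 <= bform M v v.
Proof.
move=> [_ Mpos]; have [->|v0] := eqVneq v 0; first by rewrite bform0l.
exact/ltW/Mpos.
Qed.

(* [0 <= q (v - t M^-1 v) = q v - 2 t |v|^2 + t^2 v^T M^-1 v], with [q] the
   form of [M] and [t] small, bounds [q] from below without compactness. *)
Lemma posdef_coercive (R : realType) p (M : 'M[R]_p) : posdef M ->
  exists2 c : R, 0 < c & forall v, c * dot v v <= bform M v v.
Proof.
move=> Mpos; have [Msym Mgt0] := Mpos.
have Munit : M \in unitmx.
  apply: unitmx_ker0 => v Mv0; apply/eqP; apply: contraT => /Mgt0.
  by rewrite -mulmxA Mv0 mulmx0 mxE ltxx.
have [C C0 leC] := bform_le_dot (invmx M).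
(* With t = 1/C one has t^2 v^T M^-1 v <= t |v|^2, which leaves q v >= t |v|^2. *)
exists C^-1; first by rewrite invr_gt0.
move=> v; have := posdef_ge0 (v + (- C^-1) *: (invmx M *m v)) Mpos.
have e1 : bform M v (invmx M *m v) = dot v v.
  by rewrite bform_dot mulmxA mulmxV // mul1mx.
have e2 : bform M (invmx M *m v) v = dot v v by rewrite -bformT Msym.
have e3 : bform M (invmx M *m v) (invmx M *m v) = bform (invmx M) v v.
  by rewrite bform_dot mulmxA mulmxV // mul1mx dotC bform_dot.
rewrite !(bformDl, bformDr, bformZl, bformZr) e1 e2 e3 => ge0.
have C1 : C^-1 * bform (invmx M) v v <= dot v v.
  by rewrite ler_pdivrMl.
have : C^-1 * (C^-1 * bform (invmx M) v v) <= C^-1 * dot v v.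
  by rewrite ler_wpM2l // invr_ge0 ltW.
by lra.
Qed.

Lemma mulmx_dot_le (R : realType) p q (A : 'M[R]_(p, q)) :
  exists2 C : R, 0 < C & forall v, dot (A *m v) (A *m v) <= C * dot v v.
Proof.
have [C C0 leC] := bform_le_dot (A^T *m A); exists C => // v.
suff <- : bform (A^T *m A) v v = dot (A *m v) (A *m v) by [].
by rewrite /dot /bform trmx_mul !mulmxA.
Qed.

(** A supremum dominates its set only when the set is bounded above, which [mulmx_dot_le] ensures;
    the claim for nonzero [v] follows by scaling [v] to norm one. *)
Lemma spectral_norm_dot (R : realType) p q (A : 'M[R]_(p, q)) (a : R) v :
  0 < a -> spectral_norm A <= a -> dot (A *m v) (A *m v) <= a ^+ 2 * dot v v.
Proof.
move=> a0 Aa.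
have [C C0 leC] := mulmx_dot_le A.
have ub : has_ubound
    [set enorm (A *m w) | w in [set w : 'cV[R]_q | enorm w <= 1]].
  exists (1 + C) => _ [w /= w1 <-].
  have w2 : dot w w <= 1 by rewrite -sqr_enorm expr_le1 // sqrtr_ge0.
  rewrite -(@ler_pXn2r _ 2) // ?nnegrE ?sqrtr_ge0 ?addr_ge0 ?(ltW C0) //.
  by rewrite sqr_enorm; apply: le_trans (leC w) _; nra.
have [v0|v0] := eqVneq (dot v v) 0.
  by rewrite (dot_eq0 v0) mulmx0 /dot !mulmx0 mxE mulr0.
have ev0 : 0 < enorm v.
  by rewrite lt_def sqrtr_ge0 andbT -sqrf_eq0 sqr_enorm.
have : enorm (A *m ((enorm v)^-1 *: v)) <= a.
  apply: le_trans Aa; apply: ub_le_sup => //; exists ((enorm v)^-1 *: v) => //=.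
  rewrite -(@ler_pXn2r _ 2) // ?nnegrE ?sqrtr_ge0 //.
  rewrite sqr_enorm dotZl dotZr -sqr_enorm mulrA -expr2 -exprMn.
  by rewrite mulVf ?gt_eqF ?expr1n.
rewrite -(@ler_pXn2r _ 2) // ?nnegrE ?sqrtr_ge0 ?(ltW a0) //.
rewrite sqr_enorm -scalemxAr dotZl dotZr mulrA -expr2 exprVn sqr_enorm.
have vv0 : 0 < dot v v by rewrite lt_def v0 dot_ge0.
by rewrite ler_pdivrMl // [leRHS]mulrC.
Qed.

(** * Jensen's inequality for increments and the reciprocally convex combination *)

Lemma bform_increments_le (R : realType) p (M : 'M[R]_p) (y : nat -> 'cV[R]_p)
    (a N : nat) : possemidef M ->
  bform M (y (a + N)%N - y a) (y (a + N)%N - y a) <=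
  N%:R * \sum_(i < N) bform M (y (a + i).+1 - y (a + i)%N)
                              (y (a + i).+1 - y (a + i)%N).
Proof.
move=> [Msym Mge0]; elim: N => [|N IH].
  by rewrite addn0 subrr bform0l mul0r.
rewrite big_ord_recr /= addnS.
have -> : y (a + N).+1 - y a =
    (y (a + N)%N - y a) + (y (a + N).+1 - y (a + N)%N).
  by rewrite [RHS]addrC subrKA.
move: IH; move: (y (a + N).+1 - _) => d; case: N => [|N].
  rewrite addn0 subrr big_ord0 => _.
  by rewrite add0r mul1r add0r lexx.
move: (y _ - y a) => s; set Sg := \sum_(i < _) _ => IH.
rewrite !(bformDl, bformDr) (bformC d s) //.
(* With t = [N.+1] the number of earlier increments, [s - t d] gives 2 t M(s,d) <= M(s,s) + t^2
   M(d,d). The goal is multiplied by t below, so t = 0 was treated apart. *)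
have := Mge0 (s + - (N.+1%:R) *: d).
rewrite -/(bform M _ _) !(bformDl, bformDr, bformZl, bformZr) (bformC d s) //.
have := Mge0 d; rewrite -/(bform M d d).
have N0 : 0 < N.+1%:R :> R by rewrite ltr0n.
rewrite -(natr1 N.+1); move: (N.+1%:R : R) N0 IH => t t0 IH dd ge0.
rewrite -(ler_pM2l t0); nra.
Qed.

(* The form of [R1], [S12] at [(q a, - p b)] yields the cross term of the
   reciprocally convex combination [(h / p) |a|^2 + (h / q) |b|^2]. *)
Lemma reciprocally_convex_le (R : realType) n (M S : 'M[R]_n)
    (y : nat -> 'cV[R]_n) (k h d : nat) (a b : 'cV[R]_n) :
  possemidef M -> possemidef (block_mx M S S^T M) -> (d <= h)%N ->
  a = y (k + h)%N - y (k + h - d)%N -> b = y (k + h - d)%N - y k ->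
  bform M a a + bform M b b + 2 * bform S a b <=
  h%:R * \sum_(i < h) bform M (y (k + i).+1 - y (k + i)%N)
                              (y (k + i).+1 - y (k + i)%N).
Proof.
move=> Mpsd [_ MSge0] dh; have [q ->] : exists q, h = (q + d)%N.
  by exists (h - d)%N; rewrite subnK.
have -> : (k + (q + d) - d = k + q)%N by rewrite addnA addnK.
rewrite addnA => defa defb; rewrite big_split_ord /=.
have Ja := @bform_increments_le _ _ _ y (k + q) d Mpsd.
have Jb := @bform_increments_le _ _ _ y k q Mpsd.
rewrite -defa in Ja; rewrite -defb in Jb.
under [X in _ * (_ + X)]eq_bigr do rewrite addnA.
move: Ja Jb; set Sa := \sum_(i < d) _; set Sb := \sum_(i < q) _ => Ja Jb.
have Ma : 0 <= bform M a a by apply: Mpsd.2.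
have Mb : 0 <= bform M b b by apply: Mpsd.2.
have := MSge0 (col_mx (q%:R *: a) (- (d%:R) *: b)).
rewrite -/(bform _ _ _) bform_col !bform_row bformT.
rewrite !(bformZl, bformZr) natrD.
(* The main estimate is multiplied by [d q]; when a factor is 0, the corresponding vector [a] or [b]
   vanishes and Jensen's inequality for the other suffices. *)
have [d0|d0] := posnP d.
  have a0 : a = 0 by rewrite defa d0 addn0 subrr.
  have -> : Sa = 0 by rewrite /Sa d0 big_ord0.
  by move=> _; rewrite a0 !bform0l d0; lra.
have [q0|q0] := posnP q.
  have b0 : b = 0 by rewrite defb q0 addn0 subrr.
  have -> : Sb = 0 by rewrite /Sb q0 big_ord0.
  by move=> _; rewrite b0 bform0l bform0r q0; lra.
have q1 : 0 < q%:R :> R by rewrite ltr0n.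
have d1 : 0 < d%:R :> R by rewrite ltr0n.
move: (q%:R : R) (d%:R : R) q1 d1 Ja Jb => s t s0 t0 Ja Jb ge0.
have ts : 0 < t * s by rewrite mulr_gt0.
rewrite -(ler_pM2l ts).
have := ler_wpM2l (mulr_ge0 (ltW s0) (ltW (addr_gt0 s0 t0))) Ja.
have := ler_wpM2l (mulr_ge0 (ltW t0) (ltW (addr_gt0 s0 t0))) Jb.
by lra.
Qed.

(** * The Lyapunov-Krasovskii functional, its one-step change and the form of [Phi_mx] *)

Lemma sum_shift (R : realType) (f : nat -> R) (k h : nat) :
  \sum_(i < h) f (k.+1 + i)%N = \sum_(i < h) f (k + i)%N + f (k + h)%N - f k.
Proof.
elim: h => [|h IH]; first by rewrite !big_ord0 addn0; ring.
by rewrite !big_ord_recr /= IH addSnnS; ring.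
Qed.

(** Moving the window by one lowers every old weight by one, so [f k] drops out, and [f (k + h)]
    enters with weight [h]. *)
Lemma weighted_sum_shift (R : realType) (f : nat -> R) (k h : nat) :
  \sum_(i < h) i.+1%:R * f (k.+1 + i)%N =
  \sum_(i < h) i.+1%:R * f (k + i)%N + h%:R * f (k + h)%N
  - \sum_(i < h) f (k + i)%N.
Proof.
elim: h => [|h IH]; first by rewrite !big_ord0; ring.
by rewrite !big_ord_recr /= IH addSnnS -natr1; ring.
Qed.

(* With [w] the state and [y i = w (i - h)], the double sum
   [sum_(-h <= m < 0) sum_(k + m <= j < k)] over increments of [w] counts the
   increment [y (k + i).+1 - y (k + i)] exactly [i.+1] times. *)
Definition lyap (R : realType) n (P S M : 'M[R]_n) (h : nat)
    (y : nat -> 'cV[R]_n) (k : nat) : R :=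
  bform P (y (k + h)%N) (y (k + h)%N)
  + \sum_(i < h) bform S (y (k + i)%N) (y (k + i)%N)
  + h%:R * \sum_(i < h) i.+1%:R * bform M (y (k + i).+1 - y (k + i)%N)
                                          (y (k + i).+1 - y (k + i)%N).

(** Shifting the weighted sum releases the plain sum of increments, which pays for the reciprocally
    convex terms. *)
Lemma lyap_step (R : realType) n (P S M : 'M[R]_n) h y k :
  let w := y (k + h)%N in let w' := y (k + h).+1 in
  lyap P S M h y k.+1 - lyap P S M h y k =
  bform P w' w' - bform P w w + bform S w w - bform S (y k) (y k)
  + h%:R ^+ 2 * bform M (w' - w) (w' - w)
  - h%:R * \sum_(i < h) bform M (y (k + i).+1 - y (k + i)%N)
                                (y (k + i).+1 - y (k + i)%N).
Proof.
move=> w w'; rewrite /lyap.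
rewrite (sum_shift (fun i => bform S (y i) (y i))).
rewrite (weighted_sum_shift (fun i => bform M (y i.+1 - y i) (y i.+1 - y i))).
by rewrite addSn -/w -/w'; ring.
Qed.

Lemma lyap_ge (R : realType) n (P S M : 'M[R]_n) h y k :
  (forall v, 0 <= bform S v v) -> (forall v, 0 <= bform M v v) ->
  bform P (y (k + h)%N) (y (k + h)%N) <= lyap P S M h y k.
Proof.
move=> S0 M0; rewrite /lyap -addrA lerDl addr_ge0 ?sumr_ge0 //.
by rewrite mulr_ge0 // sumr_ge0 // => i _; rewrite mulr_ge0.
Qed.

(** Groups the entries by their role: the negated [lyap_step] without its increment sum, the left
    sides of [reciprocally_convex_le] for the two delays, and the product that encodes the
    dynamics. *)
Lemma Phi_mxE (R : realType) n T hbar (eps : R) (X0 X1 : 'M[R]_(n, T))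
    (P S R1 R2 S12_1 S12_2 : 'M[R]_n) (Q1 Q2 Q3 : 'M[R]_(T, n))
    (w1 w2 w3 w4 w5 : 'cV[R]_n) :
  R1^T = R1 -> R2^T = R2 ->
  let q := Q3 *m w1 + Q2 *m w2 + Q1 *m w3 in
  let w := col5 w1 w2 w3 w4 w5 in
  bform (Phi_mx hbar eps X0 X1 P S R1 R2 S12_1 S12_2 Q1 Q2 Q3) w w =
  bform P w1 w1 - bform P w5 w5 - bform S w1 w1 + bform S w4 w4
  - hbar%:R ^+ 2 * bform (R1 + R2) (w5 - w1) (w5 - w1)
  + (bform R1 (w1 - w2) (w1 - w2) + bform R1 (w2 - w4) (w2 - w4)
     + 2 * bform S12_1 (w1 - w2) (w2 - w4))
  + (bform R2 (w1 - w3) (w1 - w3) + bform R2 (w3 - w4) (w3 - w4)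
     + 2 * bform S12_2 (w1 - w3) (w3 - w4))
  + 2 * dot (w1 + eps *: w5) (X0 *m Q3 *m w5 - X1 *m q).
Proof.
move=> R1s R2s q w; rewrite /Phi_mx /symblock5 /w /q /col5 /row5.
rewrite !(bform_col, bform_row) !bformT -!bform1.
rewrite -trmx_mul.
rewrite !(bformD, bformN, bformZ, bform0, bformT, bformDl, bformDr, bformNl,
  bformNr, bformZl, bformZr, mulmxDr).
rewrite !(bformDl, bformDr, bformNl, bformNr, bformZl, bformZr, bform1).
rewrite !(bform_dot (X1 *m _)) !(bform_dot (X0 *m _)) -!mulmxA.
have R1C := fun u v => bformC u v R1s.
have R2C := fun u v => bformC u v R2s.
rewrite (R1C w2 w1) (R1C w5 w1) (R1C w4 w2).
rewrite (R2C w3 w1) (R2C w5 w1) (R2C w4 w3).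
by ring.
Qed.

(** * Lyapunov's criterion for asymptotic stability *)

Lemma normr_le_enorm (R : realType) p (v : 'cV[R]_p) : `|v| <= enorm v.
Proof.
rewrite -[leLHS]/(mx_norm v); have [->|v0] := eqVneq (mx_norm v) 0.
  exact: sqrtr_ge0.
have [[i j] -> /=] := mx_norm_neq0 v0; rewrite ord1.
rewrite -(@ler_pXn2r _ 2) // ?nnegrE ?sqrtr_ge0 //.
by rewrite sqr_enorm real_normK ?num_real // sqr_coord_le_dot.
Qed.

(** Since [V] never increases, its initial bound controls the state for all times. Being bounded
    below, [V] converges, so its decrements tend to 0, and these dominate c |x(k)|^2. *)
Lemma lyapunov_asymptotically_stable (R : realType) n hbar
    (sol : (int -> 'cV[R]_n) -> Prop) (V : (int -> 'cV[R]_n) -> nat -> R)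
    (a c C : R) :
  0 < a -> 0 < c -> 0 < C ->
  (forall x k, sol x -> a * dot (x k%:Z) (x k%:Z) <= V x k) ->
  (forall x k, sol x -> V x k.+1 <= V x k - c * dot (x k%:Z) (x k%:Z)) ->
  (forall x d, sol x -> 0 < d -> history_lt hbar d x ->
    V x 0%N <= C * d ^+ 2) ->
  asymptotically_stable hbar sol.
Proof.
move=> a0 c0 C0 Vge Vstep V0le.
have Vdecr x (solx : sol x) : {homo V x : k l / (k <= l)%N >-> l <= k}.
  move=> k l /subnK <-; elim: (l - k)%N => [|i IH]; first by rewrite add0n.
  apply: le_trans IH; rewrite addSn; apply: le_trans (Vstep _ _ solx) _.
  by rewrite lerBlDr lerDl mulr_ge0 ?dot_ge0 // ltW.
split=> [e e0|].
  (* This choice gives t < 1 and C t < a, hence C t^2 < a, without a square root. *)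
  pose t := a / (a + C).
  have aC : 0 < a + C by rewrite addr_gt0.
  have t0 : 0 < t by rewrite divr_gt0.
  have tE : t * (a + C) = a by rewrite /t divfK // gt_eqF.
  exists (e * t); first by rewrite mulr_gt0.
  move=> x solx xhist k; rewrite enorm_ltP // -(ltr_pM2l a0).
  apply: le_lt_trans (Vge _ _ solx) _.
  apply: le_lt_trans (Vdecr x solx _ _ (leq0n k)) _.
  apply: le_lt_trans (V0le x (e * t) solx _ xhist) _; first exact: mulr_gt0.
  have t1 : t < 1 by nra.
  rewrite exprMn mulrCA [ltRHS]mulrC ltr_pM2l ?exprn_gt0 //.
  by nra.
(* Every solution converges to 0, so 1 stands for an arbitrary radius. *)
exists 1 => // x solx _.
have Vcvg : cvgn (V x).
  apply: nonincreasing_is_cvgn; first exact: Vdecr.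
  exists 0 => _ [k _ <-]; apply: le_trans (Vge _ _ solx).
  by rewrite mulr_ge0 ?dot_ge0 // ltW.
have diff0 : V x k - V x k.+1 @[k --> \oo] --> (0 : R).
  rewrite -(subrr (limn (V x))); apply: cvgB => //.
  by rewrite -cvg_shiftS in Vcvg *.
apply/cvgrPdist_lt => e e0.
have ce : 0 < c * e ^+ 2 by rewrite mulr_gt0 // exprn_gt0.
move/cvgrPdist_lt : diff0 => /(_ _ ce); apply: filterS => k.
rewrite !sub0r !normrN => /(le_lt_trans (ler_norm _)) lt_ce.
(* The limit is taken in the max norm, which [enorm] dominates. *)
apply: le_lt_trans (normr_le_enorm _) _.
rewrite enorm_ltP // -(ltr_pM2l c0); apply: le_lt_trans lt_ce.
by rewrite lerBrDl -lerBrDr Vstep.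
Qed.

Lemma lyap_init_le (R : realType) n (P S M : 'M[R]_n) h :
  exists2 C : R, 0 < C & forall y r,
    (forall i, (i <= h)%N -> dot (y i) (y i) <= r) -> lyap P S M h y 0 <= C * r.
Proof.
have [CP CP0 leP] := bform_le_dot P.
have [CS CS0 leS] := bform_le_dot S.
have [CM CM0 leM] := bform_le_dot M.
(* The factor 4 comes from |u - v|^2 <= 2 |u|^2 + 2 |v|^2 with both squares at most [r]. *)
exists (CP + \sum_(i < h) CS + h%:R * \sum_(i < h) i.+1%:R * (CM * 4)).
  rewrite -addrA ltr_wpDr // addr_ge0 //.
    by rewrite sumr_ge0 // => i _; exact: ltW.
  by rewrite mulr_ge0 // sumr_ge0 // => i _; rewrite !mulr_ge0 // ltW.
move=> y r yr; rewrite /lyap !mulrDl -mulrA !mulr_suml !lerD //.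
- by apply: le_trans (leP _) _; rewrite ler_wpM2l ?(ltW CP0) // yr ?add0n.
- apply: ler_sum => i _; apply: le_trans (leS _) _.
  by rewrite ler_wpM2l ?(ltW CS0) // yr // add0n ltnW.
rewrite ler_wpM2l // ler_sum // => i _; rewrite -!mulrA ler_wpM2l //.
apply: le_trans (leM _) _; rewrite ler_wpM2l ?(ltW CM0) //.
apply: le_trans (dot_sub_le _ _) _; rewrite add0n.
by have := yr i (ltnW (ltn_ord i)); have := yr i.+1 (ltn_ord i); lra.
Qed.

(** * The data equation under noise and robustness of the matrix inequality *)

Lemma mulmx_data_mx (R : realType) p q T (A : 'M[R]_(p, q))
    (z : int -> 'cV[R]_q) s :
  A *m data_mx T z s = data_mx T (fun k => A *m z k) s.
Proof.
by apply/matrixP => i j; rewrite !mxE; apply: eq_bigr => l _; rewrite mxE.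
Qed.

Lemma data_mxD (R : realType) p T (z z1 z2 : int -> 'cV[R]_p) s :
  (forall j : nat, (j < T)%N -> z (s + j%:Z) = z1 (s + j%:Z) + z2 (s + j%:Z)) ->
  data_mx T z s = data_mx T z1 s + data_mx T z2 s.
Proof. by move=> zD; apply/matrixP => i j; rewrite !mxE zD // mxE. Qed.

(** The nominal data satisfy the system equation column by column; writing nominal as recorded minus
    noise collects all noise terms into Delta. *)
Lemma noisy_data_eq (R : realType) (n m T hbar hd1 hd2 : nat)
  (A0 A1 : 'M[R]_n) (B : 'M[R]_(n, m))
  (x xnom xdel : int -> 'cV[R]_n) (u unom udel : int -> 'cV[R]_m) :
  (hd1 <= hbar)%N -> (hd2 <= hbar)%N ->
  (forall k : int, - hbar%:Z <= k -> k <= T%:Z -> x k = xnom k + xdel k) ->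
  (forall k : int, - hbar%:Z <= k -> k <= T%:Z -> u k = unom k + udel k) ->
  (forall k : nat, (k < T)%N -> delay_step A0 A1 B hd1 hd2 xnom unom k) ->
  data_mx T x 1 + (row_mx B (row_mx A1 A0) *m W_mx T hd1 hd2 udel xdel
                   - data_mx T xdel 1) =
  B *m data_mx T u (- hd2%:Z) + A1 *m data_mx T x (- hd1%:Z)
  + A0 *m data_mx T x 0.
Proof.
move=> hd1_le hd2_le x_data u_data nominal.
rewrite /W_mx !mul_row_col.
rewrite (@data_mxD _ _ _ x xnom xdel 1); last first.
  by move=> j jT; apply: x_data; lia.
rewrite (@data_mxD _ _ _ u unom udel (- hd2%:Z)); last first.
  by move=> j jT; apply: u_data; lia.
rewrite (@data_mxD _ _ _ x xnom xdel (- hd1%:Z)); last first.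
  by move=> j jT; apply: x_data; lia.
rewrite (@data_mxD _ _ _ x xnom xdel 0); last first.
  by move=> j jT; apply: x_data; lia.
rewrite !mulmxDr.
have -> : data_mx T xnom 1 = A0 *m data_mx T xnom 0
    + A1 *m data_mx T xnom (- hd1%:Z) + B *m data_mx T unom (- hd2%:Z).
  rewrite !mulmx_data_mx; apply/matrixP => i j.
  have /(congr1 (fun v : 'cV[R]_n => v i 0)) := nominal j (ltn_ord j).
  by rewrite !mxE add0r [1 + _]addrC ![- _ + _]addrC.
move: (A0 *m _) (A1 *m _) (B *m _) (A0 *m _) (A1 *m _) (B *m _) => a b c d e f.
by apply/matrixP => i j; rewrite !mxE; ring.
Qed.

(* Schur complement at the test vector [(w, - Q w / lambda)], followed by
   [2 a^T Delta q <= mu |a|^2 + |Delta q|^2 / mu]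
   with [mu = lambda alpha^2 / (1 + eps^2)]. *)
Lemma Phi_robust (R : realType) (n T : nat) (eps alpha lambda : R)
    (Phi : 'M[R]_(n + (n + (n + (n + n))))) (Q1 Q2 Q3 : 'M[R]_(T, n))
    (Delta : 'M[R]_(n, T)) :
  0 < alpha -> 0 < lambda -> spectral_norm Delta <= alpha ->
  posdef (block_mx (Phi - (alpha ^+ 2 * lambda)%:M) (Q_mx eps Q1 Q2 Q3)^T
                   (Q_mx eps Q1 Q2 Q3) lambda%:M) ->
  exists2 c : R, 0 < c & forall (w1 w2 w3 w4 w5 : 'cV[R]_n) w q,
    w = col5 w1 w2 w3 w4 w5 -> q = Q3 *m w1 + Q2 *m w2 + Q1 *m w3 ->
    c * dot w w <= bform Phi w w - 2 * dot (w1 + eps *: w5) (Delta *m q).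
Proof.
move=> alpha0 lambda0 Delta_le /posdef_coercive [c c0 cle].
exists c => // w1 w2 w3 w4 w5 w q defw defq.
set z := col5 (- lambda^-1 *: q) 0 0 0 (- (lambda^-1 * eps) *: q).
have := cle (col_mx w z).
rewrite bform_col !bform_row bformT bformD bformN !bform_scalar dot_col.
have -> : bform (Q_mx eps Q1 Q2 Q3) z w =
    - lambda^-1 * (1 + eps ^+ 2) * dot q q.
  rewrite /z /Q_mx defw /col5 /row5.
  rewrite !(bform_col, bform_row, bform0l, bform0, bformZ, bformZl) !bform_dot.
  by rewrite [X in _ = _ * dot _ X]defq !dotDr; ring.
have -> : dot z z = lambda^-1 ^+ 2 * (1 + eps ^+ 2) * dot q q.
  by rewrite /z /col5 !dot_col !(dotZl, dotZr) !dot0l; ring.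
have DD := spectral_norm_dot q alpha0 Delta_le.
set a := w1 + _; set D := Delta *m q in DD *.
pose e1 := 1 + eps ^+ 2.
have e10 : 0 < e1 by rewrite ltr_pwDl // sqr_ge0.
(* Cauchy-Schwarz for the weights (1, eps), read off from |eps w1 - w5|^2 >= 0. *)
have aw : dot a a <= e1 * (dot w1 w1 + dot w5 w5).
  have := dot_ge0 (eps *: w1 - w5).
  rewrite /a /e1 -!bform1.
  rewrite !(bformDl, bformDr, bformNl, bformNr, bformZl, bformZr).
  by rewrite (bformC w5 w1) ?tr_scalar_mx //; lra.
move: a D aw DD => a D aw DD.
have ww : dot w1 w1 + dot w5 w5 <= dot w w.
  rewrite defw /col5 !dot_col.
  by have := dot_ge0 w2; have := dot_ge0 w3; have := dot_ge0 w4; lra.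
(* This [mu] bounds the two terms of Young's inequality by lambda alpha^2 |w|^2 and (1 + eps^2)
   |q|^2 / lambda, exactly what the matrix inequality subtracts from the form of [Phi]. *)
pose mu := lambda * alpha ^+ 2 / e1.
have mu0 : 0 < mu by rewrite !mulr_gt0 ?invr_gt0 ?exprn_gt0.
have aD : 2 * dot a D <= mu * dot a a + mu^-1 * dot D D.
  have := dot_ge0 (mu *: a - D).
  rewrite -!bform1 !(bformDl, bformDr, bformNl, bformNr, bformZl, bformZr).
  rewrite (bformC D a) ?tr_scalar_mx // => ge0.
  rewrite -(ler_pM2l mu0) mulrDr [mu * (mu^-1 * _)]mulrA divff ?gt_eqF //.
  by lra.
have muDD : mu^-1 * dot D D <= e1 / lambda * dot q q.
  rewrite ler_pdivrMl // (le_trans DD) // /mu.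
  rewrite le_eqVlt; apply/orP; left; apply/eqP; field.
  by rewrite !gt_eqF.
have muaa : mu * dot a a <= lambda * alpha ^+ 2 * dot w w.
  have -> : lambda * alpha ^+ 2 * dot w w = mu * (e1 * dot w w).
    by rewrite /mu mulrA divfK ?gt_eqF.
  by rewrite ler_pM2l //; apply: le_trans aw _; rewrite ler_pM2l.
have qq : 0 <= c * (lambda^-1 ^+ 2 * e1 * dot q q).
  apply: mulr_ge0; first exact: ltW.
  apply: mulr_ge0; last exact: dot_ge0.
  by apply: mulr_ge0; [exact: sqr_ge0|exact: ltW].
have -> : lambda * (lambda^-1 ^+ 2 * (1 + eps ^+ 2) * dot q q) =
    e1 / lambda * dot q q.
  by rewrite /e1; field; rewrite gt_eqF.
by rewrite -/e1; lra.
Qed.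

Theorem theorem5p3 (R : realType) (n m T hbar hd1 hd2 : nat)
  (A0 A1 : 'M[R]_n) (B : 'M[R]_(n, m))
  (x xnom xdel : int -> 'cV[R]_n) (u unom udel : int -> 'cV[R]_m)
  (alpha eps lambda : R)
  (P S R1 R2 S12_1 S12_2 : 'M[R]_n) (Q1 Q2 Q3 : 'M[R]_(T, n))
  (hbar_gt0 : (0 < hbar)%N) (hbar_lt_T : (hbar < T)%N)
  (hd1_le : (hd1 <= hbar)%N) (hd2_le : (hd2 <= hbar)%N)
  (x_data : forall k : int, - hbar%:Z <= k -> k <= T%:Z ->
     x k = xnom k + xdel k)
  (u_data : forall k : int, - hbar%:Z <= k -> k <= T%:Z ->
     u k = unom k + udel k)
  (nominal : forall k : nat, (k < T)%N ->
     delay_step A0 A1 B hd1 hd2 xnom unom k) :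
  let U := data_mx T u (- hd2%:Z) in
  let Xh := data_mx T x (- hd1%:Z) in
  let X0 := data_mx T x 0 in
  let X1 := data_mx T x 1 in
  let W0 := W_mx T hd1 hd2 u x in
  let W0del := W_mx T hd1 hd2 udel xdel in
  let X1del := data_mx T xdel 1 in
  let Delta := row_mx B (row_mx A1 A0) *m W0del - X1del in
  let Phi := Phi_mx hbar eps X0 X1 P S R1 R2 S12_1 S12_2 Q1 Q2 Q3 in
  let Q := Q_mx eps Q1 Q2 Q3 in
  let K := U *m Q1 *m invmx (X0 *m Q3) in
  \rank W0 = (m + 2 * n)%N ->
  0 < alpha ->
  spectral_norm Delta <= alpha ->
  0 < eps ->
  0 < lambda ->
  posdef P -> posdef S -> posdef R1 -> posdef R2 ->
  posdef (block_mx (Phi - (alpha ^+ 2 * lambda)%:M) Q^T Q lambda%:M) ->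
  possemidef (block_mx R1 S12_1 S12_1^T R1) ->
  possemidef (block_mx R2 S12_2 S12_2^T R2) ->
  U *m Q2 = 0 -> U *m Q3 = 0 ->
  Xh *m Q1 = 0 -> Xh *m Q3 = 0 ->
  X0 *m Q1 = 0 -> X0 *m Q2 = 0 ->
  Xh *m Q2 = X0 *m Q3 ->
  forall h1 h2 : nat -> nat,
    (forall k : nat, (h1 k <= hbar)%N) ->
    (forall k : nat, (h2 k <= hbar)%N) ->
    asymptotically_stable hbar (closed_loop A0 A1 B K h1 h2).
Proof.
move=> U Xh X0 X1 W0 W0del X1del Delta Phi Q K _ alpha0 Delta_le _ lambda0.
move=> Ppos Spos R1pos R2pos LMI RS1 RS2.
move=> UQ2 UQ3 XhQ1 XhQ3 X0Q1 X0Q2 XhQ2 h1 h2 h1_le h2_le.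
have dataE : X1 + Delta = B *m U + A1 *m Xh + A0 *m X0.
  exact: noisy_data_eq hd1_le hd2_le x_data u_data nominal.
have [c c0 PhiP] := Phi_robust alpha0 lambda0 Delta_le LMI.
pose Y := X0 *m Q3.
have R1sym := R1pos.1; have R2sym := R2pos.1.
have M0 v : 0 <= bform (R1 + R2) v v by rewrite bformD addr_ge0 // posdef_ge0.
(* If Y v = 0, the form at (0, 0, 0, 0, v) has q = 0 and reduces to - P(v,v) - hbar^2 (R1 + R2)(v,v)
   <= 0, so its coercivity forces v = 0. *)
have Yunit : Y \in unitmx.
  apply: unitmx_ker0 => v Yv0.
  have := PhiP 0 0 0 0 v _ _ erefl erefl.
  rewrite Phi_mxE // !mulmx0 !addr0 !subr0 !bform0l mulmx0 Yv0 !subr0 mulmx0.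
  rewrite !dot0r.
  have -> : dot (col5 0 0 0 0 v) (col5 0 0 0 0 v) = dot v v.
    by rewrite /col5 !dot_col !dot0l !add0r.
  move=> cv; apply: dot_eq0; apply/le_anti.
  rewrite dot_ge0 andbT -(ler_pM2l c0) mulr0; apply: le_trans cv _.
  have := posdef_ge0 v Ppos; have := mulr_ge0 (sqr_ge0 (hbar%:R : R)) (M0 v).
  by lra.
have KY : K *m Y = U *m Q1 by rewrite /K -mulmxA mulVmx ?mulmx1.
have XQ3 : (X1 + Delta) *m Q3 = A0 *m Y.
  by rewrite dataE !mulmxDl -!mulmxA UQ3 XhQ3 !mulmx0 !add0r.
have XQ2 : (X1 + Delta) *m Q2 = A1 *m Y.
  by rewrite dataE !mulmxDl -!mulmxA UQ2 X0Q2 XhQ2 !mulmx0 add0r addr0.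
have XQ1 : (X1 + Delta) *m Q1 = B *m K *m Y.
  rewrite -[RHS]mulmxA KY dataE !mulmxDl -!mulmxA X0Q1 XhQ1 !mulmx0.
  by rewrite !addr0.
(* The shift by [hbar] puts the start of the history at index 0, as [lyap] expects; the current
   state has index [k + hbar]. *)
pose y (z : int -> 'cV[R]_n) (i : nat) := invmx Y *m z (i%:Z - hbar%:Z).
have Yy z i : Y *m y z i = z (i%:Z - hbar%:Z) by rewrite mulKVmx.
have Yyh z (k d : nat) : (d <= hbar)%N ->
    Y *m y z (k + hbar - d)%N = z (k%:Z - d%:Z).
  by move=> d_le; rewrite Yy; congr z; lia.
have Yyh0 z (k : nat) : Y *m y z (k + hbar)%N = z k%:Z.
  by rewrite Yy; congr z; lia.
have [p p0 Pge] := posdef_coercive Ppos.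
have [CY CY0 leY] := mulmx_dot_le Y.
have [CI CI0 leI] := mulmx_dot_le (invmx Y).
have [CL CL0 leL] := lyap_init_le P S (R1 + R2) hbar.
have dotx z k : dot (z k%:Z) (z k%:Z) <=
    CY * dot (y z (k + hbar)%N) (y z (k + hbar)%N) by rewrite -Yyh0.
(* The factors [CY] and [CI] translate between x = Y w and w = Y^-1 x. *)
apply: (@lyapunov_asymptotically_stable _ _ _ _
  (fun z => lyap P S (R1 + R2) hbar (y z)) (p / CY) (c / CY) (CL * CI)).
- exact: divr_gt0.
- exact: divr_gt0.
- exact: mulr_gt0.
- move=> z k _; apply: le_trans (lyap_ge _ _ _ _ _ _) => //; last first.
    by move=> v; exact: posdef_ge0.
  apply: le_trans (Pge _); rewrite -mulrA ler_pM2l //.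
  by rewrite ler_pdivrMl.
- move=> z k solz.
  set w1 := y z (k + hbar)%N; set w2 := y z (k + hbar - h1 k)%N.
  set w3 := y z (k + hbar - h2 k)%N; set w5 := y z (k + hbar).+1.
  (* The closed loop in the coordinates w, with the unknown matrices replaced by data and Delta. *)
  have step : Y *m w5 = (X1 + Delta) *m (Q3 *m w1 + Q2 *m w2 + Q1 *m w3).
    rewrite !mulmxDr !(mulmxA (X1 + Delta)) XQ3 XQ2 XQ1.
    rewrite -(mulmxA A0) -(mulmxA A1) -(mulmxA (B *m K)).
    rewrite Yyh0 !Yyh // -(mulmxA B) Yy.
    have := solz k; rewrite /delay_step => <-.
    by congr z; clear; lia.
  have step' : Y *m w5 - X1 *m (Q3 *m w1 + Q2 *m w2 + Q1 *m w3) =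
      Delta *m (Q3 *m w1 + Q2 *m w2 + Q1 *m w3).
    by rewrite step mulmxDl addrC addKr.
  (* The fourth vector is Y^-1 z(k - hbar). By [step'] the product with the dynamics cancels the
     Delta term of [PhiP]. *)
  have := PhiP w1 w2 w3 (y z k) w5 _ _ erefl erefl.
  rewrite Phi_mxE // -/Y step'.
  have := lyap_step P S (R1 + R2) hbar (y z) k.
  rewrite -/w1 -/w5 /=.
  have M1psd : possemidef R1 by split => // v; exact: posdef_ge0.
  have M2psd : possemidef R2 by split => // v; exact: posdef_ge0.
  have := @reciprocally_convex_le _ _ _ _ (y z) k _ _ _ _
    M1psd RS1 (h1_le k) erefl erefl.
  have := @reciprocally_convex_le _ _ _ _ (y z) k _ _ _ _
    M2psd RS2 (h2_le k) erefl erefl.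
  rewrite -/w1 -/w2 -/w3.
  (* The single increment sum for [R1 + R2] splits into the two sums that bound the terms of the two
     delays. *)
  under [in X in _ -> _ -> X -> _]eq_bigr do rewrite bformD.
  rewrite big_split /= => rc2 rc1 stepL PhiL.
  have dw : dot w1 w1 <=
      dot (col5 w1 w2 w3 (y z k) w5) (col5 w1 w2 w3 (y z k) w5).
    by rewrite /col5 !dot_col lerDl !addr_ge0 ?dot_ge0.
  have cx : c / CY * dot (z k%:Z) (z k%:Z) <= c * dot w1 w1.
    by rewrite -mulrA ler_pM2l // ler_pdivrMl.
  have cw := ler_wpM2l (ltW c0) dw.
  by lra.
(* The indices i <= hbar of the initial window are the times i - hbar in [- hbar, 0] of the
   history. *)
move=> z d _ d0 hist; rewrite -mulrA; apply: leL => i ile.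
apply: le_trans (leI _) _; rewrite ler_pM2l // ltW // -enorm_ltP //.
by apply: hist; move: ile; clear; lia.
Qed.
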